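(* Let $S$ be a numerical semigroup. For any gap $g$ of $S$, the ideal $\{0,g\}+S$ is irreducible in $\mathcal{I}_0(S)$.
   Context: $\mathbb{N}$ denotes the non-negative integers. A numerical semigroup $S$ is a submonoid of $(\mathbb{N},+)$ with finite complement in $\mathbb{N}$; the elements of $\mathbb{N}\setminus S$ are its gaps. For a set $X$ of integers, $X+S=\{x+s: x\in X, s\in S\}$. $\mathcal{I}_0(S)=\{E\subseteq\mathbb{N}: E+S\subseteq E,\ \min(E)=0\}$ is the set of ideals of $S$ with minimum $0$; it is a commutative monoid under $I+J=\{a+b: a\in I, b\in J\}$, with identity $S$, and $S$ is its only unit. For $I,J\in\mathcal{I}_0(S)$, $I\preceq J$ means $J=I+K$ for some $K\in\mathcal{I}_0(S)$, and $I\prec J$ means $I\preceq J$ and $J\not\preceq I$ (equivalently, $I\preceq J$ and $I\ne J$). A non-unit $I$ (that is, $I\neq S$) is irreducible if $I\ne J+K$ for all non-units $J,K$ with $J\prec I$ and $K\prec I$. *)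

(* Defs.v *)
From mathcomp Require Import all_boot.
From mathcomp Require Import boolp classical_sets functions cardinality.

Set Implicit Arguments.
Unset Strict Implicit.
Unset Printing Implicit Defensive.

Local Open Scope classical_set_scope.

Definition sumset (A B : set nat) : set nat :=
  [set a + b | a in A & b in B].

Definition numerical_semigroup (S : set nat) : Prop :=
  [/\ S 0, forall x y, S x -> S y -> S (x + y) & finite_set (~` S)].

Definition gap (S : set nat) (g : nat) : Prop := ~ S g.

(* For a set E of natural numbers, min E = 0 means exactly that 0 is in E. *)
Definition ideals0 (S : set nat) : set (set nat) :=
  [set E | sumset E S `<=` E /\ E 0].

Section IdealMonoid.
Variable S : set nat.

(* Invertibility in the monoid (ideals0 S, sumset), whose identity is S. *)
Definition ideal_unit (I : set nat) : Prop :=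
  ideals0 S I /\ exists2 J, ideals0 S J & sumset I J = S.

Definition ideal_le (I J : set nat) : Prop :=
  exists2 K, ideals0 S K & J = sumset I K.

Definition ideal_lt (I J : set nat) : Prop :=
  ideal_le I J /\ ~ ideal_le J I.

Definition ideal_irreducible (I : set nat) : Prop :=
  [/\ ideals0 S I, ~ ideal_unit I &
      forall J K, ideals0 S J -> ideals0 S K ->
        ~ ideal_unit J -> ~ ideal_unit K ->
        ideal_lt J I -> ideal_lt K I -> I <> sumset J K].

End IdealMonoid.

(* Main.v *)
(** If [{0,g} + S = J + K], write [g = a + b] with [a] in [J] and [b] in [K]. As
    [J] and [K] lie in [{0,g} + S], whose only element outside [S] that is at
    most [g] is [g] itself, and [g] is not in [S], one of [a], [b] equals [g].
    The corresponding factor then contains [{0,g} + S], so it equals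
    [{0,g} + S] and is not strictly smaller. *)

Require Import Defs.
From mathcomp Require Import all_boot.
From mathcomp Require Import boolp classical_sets functions cardinality.

Local Open Scope classical_set_scope.

Lemma sumsetP {A B : set nat} {x : nat} :
  sumset A B x <-> exists a b, [/\ A a, B b & x = a + b].
Proof.
split=> [[a Aa [b Bb <-]]|[a [b [Aa Bb ->]]]]; first by exists a, b.
by exists a => //; exists b.
Qed.

Lemma sumset_subl (A B : set nat) : B 0 -> A `<=` sumset A B.
Proof. by move=> B0 x Ax; apply/sumsetP; exists x, 0; rewrite addn0. Qed.

Lemma sumset_subr (A B : set nat) : A 0 -> B `<=` sumset A B.
Proof. by move=> A0 x Bx; apply/sumsetP; exists 0, x. Qed.

(** The witness is [S] itself, the identity of the monoid: [I + S = I]. *)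
Lemma ideal_le_refl (S I : set nat) :
  numerical_semigroup S -> ideals0 S I -> ideal_le S I I.
Proof.
move=> [S0 SD _] [IS _]; exists S.
  by split=> // _ /sumsetP[x [y [Sx Sy ->]]]; exact: SD.
by apply/seteqP; split=> //; exact: sumset_subl.
Qed.

Lemma ideals0_sumset_pair (S : set nat) (g : nat) :
  numerical_semigroup S -> ideals0 S (sumset [set 0; g] S).
Proof.
move=> [S0 SD _]; split; last by apply: sumset_subr => //; left.
move=> _ /sumsetP[_ [t [/sumsetP[x [s [gx Ss ->]]] St ->]]].
apply/sumsetP; exists x, (s + t); split=> //; last by rewrite addnA.
exact: SD.
Qed.

(** Both generators 0 and [g] lie in [J], and [J] absorbs [S]. *)
Lemma sumset_pair_sub (S J : set nat) (g : nat) :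
  ideals0 S J -> J g -> sumset [set 0; g] S `<=` J.
Proof.
move=> [JS J0] Jg _ /sumsetP[x [s [gx Ss ->]]]; apply: JS.
by apply/sumsetP; exists x, s; split=> //; case: gx => ->.
Qed.

(** If [g] were in [J], the two inclusions would give equality, and reflexivity of [ideal_le] would
    contradict strictness. *)
Lemma ideal_lt_pair_notin (S J : set nat) (g : nat) :
  numerical_semigroup S -> ideals0 S J -> J `<=` sumset [set 0; g] S ->
  ideal_lt S J (sumset [set 0; g] S) -> ~ J g.
Proof.
move=> hS hJ JI [_ nIJ] Jg; apply: nIJ.
have <- : J = sumset [set 0; g] S.
  by apply/seteqP; split=> //; exact: sumset_pair_sub.
exact: ideal_le_refl.
Qed.

(** An element of the form [g + s] is at least [g], so the bound forces it to be [g]. *)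
Lemma sumset_pair_leq (S : set nat) (g x : nat) :
  sumset [set 0; g] S x -> x <= g -> S x \/ x = g.
Proof.
move=> /sumsetP[_ [s [[->|->] Ss ->]]] le_xg; first by left.
by right; apply/eqP; rewrite eqn_leq le_xg leq_addr.
Qed.

Theorem proposition5p5 (S : set nat) (g : nat)
    (hS : numerical_semigroup S) (hg : gap S g) :
  ideal_irreducible S (sumset [set 0; g] S).
Proof.
have [S0 SD _] := hS.
have Ig : sumset [set 0; g] S g by apply: sumset_subl => //; right.
split; first exact: ideals0_sumset_pair.
  (* An inverse [J] contains 0, so [{0,g} + S] would lie in [S], which misses [g]. *)
  by move=> [_ [J [_ J0] IJS]]; apply: hg; rewrite -IJS; exact: sumset_subl.
move=> J K hJ hK _ _ ltJ ltK IJK.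
have JI : J `<=` sumset [set 0; g] S.
  by rewrite IJK; apply: sumset_subl; case: hK.
have KI : K `<=` sumset [set 0; g] S.
  by rewrite IJK; apply: sumset_subr; case: hJ.
have nJg := ideal_lt_pair_notin _ _ _ hS hJ JI ltJ.
have nKg := ideal_lt_pair_notin _ _ _ hS hK KI ltK.
move: (Ig); rewrite IJK => /sumsetP[a [b [Ja Kb gab]]].
have le_ag : a <= g by rewrite gab leq_addr.
have le_bg : b <= g by rewrite gab leq_addl.
have [Sa|ag] := sumset_pair_leq _ _ _ (JI _ Ja) le_ag; last first.
  by apply: nJg; rewrite -ag.
have [Sb|bg] := sumset_pair_leq _ _ _ (KI _ Kb) le_bg; last first.
  by apply: nKg; rewrite -bg.
(* Both summands are now in [S], so the gap [g] would be too. *)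
by apply: hg; rewrite gab; exact: SD.
Qed.
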